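(* Let $P_2$ be the dcpo defined in the context. Then its Scott space $\Sigma P_2$ is sober.
   Context: General notions. A dcpo is a poset in which every directed (nonempty) subset has a supremum. A subset $U$ of a poset $P$ is Scott open if it is an upper set and, for every directed $D\subseteq P$ whose supremum exists, $\sup D\in U$ implies $D\cap U\neq\emptyset$. The Scott open sets form the Scott topology $\sigma(P)$, and $\Sigma P=(P,\sigma(P))$. A $T_0$ space is sober if every nonempty irreducible closed subset is the closure of a unique singleton. $\mathbb{N}$ is the set of non-negative integers. For relations $R,S$, $R;S$ denotes the composition: $x\,(R;S)\,z$ iff there is $y$ with $x\,R\,y$ and $y\,S\,z$. Posets $\mathbb{N}^{<\mathbb{N}}$, $M$, $L$. $\mathbb{N}^{<\mathbb{N}}$ is the set of nonempty finite words over $\mathbb{N}$ with the prefix order. A word of length 1 may be identified with a natural number when indicated; $s.x$ denotes the word $s$ extended by the letter $x\in\mathbb{N}$. $M$ is the disjoint union $\mathbb{N}\cup\mathbb{N}^{<\mathbb{N}}$, where $x\le_M y$ iff either both are in $\mathbb{N}^{<\mathbb{N}}$ and $x$ is a prefix of $y$, or both are in $\mathbb{N}$ and $x\le y$ in the usual order. $L=(\{(a,b)\in\mathbb{N}\times\mathbb{N}:a<b\}\times M)\cup\{\top\}$, where $((a,b),x)\le((a',b'),y)$ iff $a=a'$, $b=b'$ and $x\le_M y$, and $u\le\top$ for all $u\in L$. Write $x_{a,b}$ for $((a,b),x)$. The maps $i$ and $f_{m,n}$. Fix an injection $i:\{(a,b)\in\mathbb{N}\times\mathbb{N}:a<b\}\to\mathcal{P}(\mathbb{N})$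 such that: (1) $i(m_1,n_1)\cap i(m_2,n_2)=\emptyset$ if $(m_1,n_1)\neq(m_2,n_2)$; (2) $n<k$ for every $k\in i(m,n)$; (3) for all $m<n$ there is a monotone injective function $f_{m,n}:\mathbb{N}^{<\mathbb{N}}\to i(m,n)$ (with $i(m,n)\subseteq\mathbb{N}$ in its usual order). Fix such functions $f_{m,n}$. (Such $i$ and $f_{m,n}$ exist.) The poset $B$. $B=\mathbb{N}\times\mathbb{N}\times L$ as a set, with relations (for $a<b$ in $\mathbb{N}$ and $m,n\in\mathbb{N}$): - $(m,n,u)\sqsubset_1(m,n,v)$ whenever $u<v$ in $L$; - $(a,n,x_{a,b})\sqsubset_2(f_{a,b}(x),n+1,\top)$ for all $x\in\mathbb{N}^{<\mathbb{N}}$; - $(b,n,x_{a,b})\sqsubset_3(f_{a,b}(x),n+1,\top)$ for all $x\in\mathbb{N}$ (in $f_{a,b}(x)$, $x$ is read as a word of length 1); - $(f_{a,b}(s),n,x_{a,b})\sqsubset_4(f_{a,b}(s.x),n,\top)$ for all $s\in\mathbb{N}^{<\mathbb{N}}$ and $x\in\mathbb{N}$. Let $\sqsubset$ be $\sqsubset_1\cup\sqsubset_2\cup\sqsubset_3\cup\sqsubset_4\cup(\sqsubset_1;\sqsubset_2)\cup(\sqsubset_1;\sqsubset_3)\cup(\sqsubset_1;\sqsubset_4)$, and let $\sqsubseteq$ be the union of $\sqsubset$ and equality; this is a partial order on $B$. The dcpo $P_2$. Fix a bijection $\phi:\mathbb{N}\to\{(a,b)\in\mathbb{N}\times\mathbb{N}:a<b\}$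 and put $E_n=i(\phi(n))$. Let $X$ be the set of all $f:\mathbb{N}\to\bigcup_{n\in\mathbb{N}}E_n$ with $f(n)\in E_n$ for every $n$. Let $P_2=(X\times\mathbb{N}\times\mathbb{N})\cup B\cup\{\top_2\}$ (disjoint union), with relations: - $(f,n,k)<_1(f,m,k)$ whenever $n<m$; - $<_2$ is $\sqsubset$ on $B$; - $(f,n,k)<_3(f(n),k,\top)$ for all $(f,n,k)\in X\times\mathbb{N}\times\mathbb{N}$; - $x<_4\top_2$ for all $x\in P_2\setminus\{\top_2\}$. The strict order on $P_2$ is $<_1\cup<_2\cup<_3\cup<_4\cup(<_1;<_3)$, and $\le$ is its union with equality. *)

(* Defs.v *)
From HB Require Import structures.
From mathcomp Require Import all_boot all_order.
From mathcomp Require Import all_classical.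
From mathcomp Require Import topology_structure separation_axioms.

Set Implicit Arguments.
Unset Strict Implicit.
Unset Printing Implicit Defensive.

Import Order.TTheory.
Local Open Scope classical_set_scope.

Section ScottOpen.
Context {d : Order.disp_t} {P : porderType d}.

Definition directed (D : set P) :=
  D !=set0 /\
  forall x y, D x -> D y -> exists z, [/\ D z, (x <= z)%O & (y <= z)%O].

Definition scott_open (U : set P) :=
  (forall x y, U x -> (x <= y)%O -> U y) /\
  (forall D x, directed D -> supremums D x -> U x -> D `&` U !=set0).

Lemma scott_openT : scott_open setT.
Proof. by split=> // D x [[y Dy] _] _ _; exists y. Qed.

Lemma scott_openI : setI_closed scott_open.
Proof.
move=> U V [upU oU] [upV oV]; split=> [x y [Ux Vx] xy|D x dD Dx [Ux Vx]].
  by split; [apply: upU xy | apply: upV xy].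
have [y [Dy Uy]] := oU _ _ dD Dx Ux.
have [z [Dz Vz]] := oV _ _ dD Dx Vx.
have [t [Dt yt zt]] := dD.2 _ _ Dy Dz.
by exists t; do 2?split=> //; [apply: upU yt | apply: upV zt].
Qed.

Lemma scott_open_bigU (I : Type) (F : I -> set P) :
  (forall j, scott_open (F j)) -> scott_open (\bigcup_j F j).
Proof.
move=> oF; split=> [x y [j _ Fx] xy|D x dD Dx [j _ Fx]].
  by exists j => //; apply: (oF j).1 xy.
have [y [Dy Fy]] := (oF j).2 _ _ dD Dx Fx.
by exists y; split=> //; exists j.
Qed.

End ScottOpen.

Definition Sigma {d : Order.disp_t} (P : porderType d) : Type := P.

Section Sigma.
Context {d : Order.disp_t} (P : porderType d).

HB.instance Definition _ := Choice.on (Sigma P).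

HB.instance Definition _ := @isOpenTopological.Build (Sigma P) scott_open
  scott_openT scott_openI (@scott_open_bigU _ _).

Lemma openSigmaE : @open (Sigma P) = scott_open.
Proof. by []. Qed.

End Sigma.

(* Nonemptiness is not part of [irreducible]; [sober] asks for it separately. *)
Definition irreducible {T : topologicalType} (A : set T) :=
  forall C D : set T, closed C -> closed D ->
    A `<=` C `|` D -> A `<=` C \/ A `<=` D.

Definition sober (T : topologicalType) :=
  kolmogorov_space T /\
  forall A : set T, A !=set0 -> closed A -> irreducible A ->
    exists! x, A = closure [set x].

Definition rcomp {T : Type} (R S : T -> T -> Prop) (x z : T) :=
  exists2 y, R x y & S y z.

Definition word := {s : seq nat | s != [::]}.

Definition word_le : rel word := fun s t => prefix (val s) (val t).

Definition word1 (x : nat) : word := exist _ [:: x] isT.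

Lemma rcons_neq0 (s : seq nat) (x : nat) : rcons s x != [::].
Proof. by case: s. Qed.

Definition word_rcons (s : word) (x : nat) : word :=
  exist _ (rcons (val s) x) (rcons_neq0 (val s) x).

Definition ltpair := {p : nat * nat | p.1 < p.2}.

Definition pfst (p : ltpair) : nat := (val p).1.
Definition psnd (p : ltpair) : nat := (val p).2.

Definition M : eqType := (nat + word)%type.

Definition leM (x y : M) : bool :=
  match x, y with
  | inl a, inl b => a <= b
  | inr s, inr t => word_le s t
  | _, _ => false
  end.

(* [None] is the top element of [L], and [Lat (a, b) x] is the element written
   x_{a,b} on paper, where [x] is [inl] of a number or [inr] of a word. *)
Definition L : eqType := option (ltpair * M).

Definition Ltop : L := None.
Definition Lat (p : ltpair) (x : M) : L := Some (p, x).

Definition leL (u v : L) : bool :=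
  match u, v with
  | _, None => true
  | None, Some _ => false
  | Some (p, x), Some (q, y) => (p == q) && leM x y
  end.

Definition ltL (u v : L) : bool := (u != v) && leL u v.

Definition B : Type := (nat * nat * L)%type.

Section OrderB.
Variable f : ltpair -> word -> nat.

Inductive ltB1 : B -> B -> Prop :=
  LtB1 m n u v of ltL u v : ltB1 (m, n, u) (m, n, v).

Inductive ltB2 : B -> B -> Prop :=
  LtB2 p n (x : word) :
    ltB2 (pfst p, n, Lat p (inr x)) (f p x, n.+1, Ltop).

Inductive ltB3 : B -> B -> Prop :=
  LtB3 p n (x : nat) :
    ltB3 (psnd p, n, Lat p (inl x)) (f p (word1 x), n.+1, Ltop).

Inductive ltB4 : B -> B -> Prop :=
  LtB4 p n (s : word) (x : nat) :
    ltB4 (f p s, n, Lat p (inl x)) (f p (word_rcons s x), n, Ltop).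

Definition ltB (x y : B) : Prop :=
  ltB1 x y \/ ltB2 x y \/ ltB3 x y \/ ltB4 x y \/
  rcomp ltB1 ltB2 x y \/ rcomp ltB1 ltB3 x y \/ rcomp ltB1 ltB4 x y.

End OrderB.

Definition E (i : ltpair -> set nat) (phi : nat -> ltpair) (n : nat) : set nat :=
  i (phi n).

Definition X (i : ltpair -> set nat) (phi : nat -> ltpair) : Type :=
  {g : nat -> nat | forall n, E i phi n (g n)}.

(* The order of [P2] depends on [f], although its carrier does not: [f] is a
   parameter of the type so that the order can be a canonical instance. *)
Inductive P2 (i : ltpair -> set nat) (f : ltpair -> word -> nat)
    (phi : nat -> ltpair) : Type :=
  | P2X of X i phi & nat & nat
  | P2B of B
  | P2top.

Arguments P2X {i f phi} _ _ _.
Arguments P2B {i f phi} _.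
Arguments P2top {i f phi}.

Section LtP2.
Context {i : ltpair -> set nat} {f : ltpair -> word -> nat}.
Context {phi : nat -> ltpair}.
Local Notation P2 := (P2 i f phi).

Inductive ltP1 : P2 -> P2 -> Prop :=
  LtP1 g n m k of n < m : ltP1 (P2X g n k) (P2X g m k).

Inductive ltP2 : P2 -> P2 -> Prop :=
  LtP2 x y of ltB f x y : ltP2 (P2B x) (P2B y).

Inductive ltP3 : P2 -> P2 -> Prop :=
  LtP3 g n k : ltP3 (P2X g n k) (P2B (sval g n, k, Ltop)).

Inductive ltP4 : P2 -> P2 -> Prop :=
  LtP4 x of x <> P2top : ltP4 x P2top.

Definition ltP (x y : P2) : Prop :=
  ltP1 x y \/ ltP2 x y \/ ltP3 x y \/ ltP4 x y \/ rcomp ltP1 ltP3 x y.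

End LtP2.

Lemma ltL_top (u : L) : ltL Ltop u = false.
Proof. by case: u. Qed.

Lemma leM_trans : transitive leM.
Proof.
move=> [b|t] [a|s] [c|r] //=; first exact: leq_trans.
exact: prefix_trans.
Qed.

Lemma leM_anti : antisymmetric leM.
Proof.
move=> [a|s] [b|t] //=; first by move=> /anti_leq ->.
rewrite /word_le => /andP[/prefixP[u tE] /prefixP[v sE]].
congr inr; apply: val_inj; move: (sE); rewrite tE -catA => /(congr1 size).
rewrite !size_cat => /eqP; rewrite -[X in X == _]addn0 eqn_add2l eq_sym addn_eq0.
by move=> /andP[/nilP u0 _]; rewrite u0 cats0.
Qed.

Lemma ltL_trans : transitive ltL.
Proof.
move=> [[q y]|] [[p x]|] [[r z]|] //=; rewrite /ltL.
move=> /andP[npq /andP[/eqP pq xy]] /andP[nqr /andP[/eqP qr yz]]; subst q r.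
rewrite /= eqxx (leM_trans xy yz) !andbT; apply/eqP => -[xz]; subst z.
by move/eqP: npq; apply; rewrite (leM_anti (introT andP (conj xy yz))).
Qed.

Section P2order.
Variables (i : ltpair -> set nat) (f : ltpair -> word -> nat).
Variable phi : nat -> ltpair.

Local Notation P2 := (P2 i f phi).

Lemma ltB_ntop (x y : B) : ltB f x y -> x.2 <> Ltop.
Proof.
have h1 u v : ltB1 u v -> u.2 <> Ltop.
  by case=> m n [[p z]|] w //=; rewrite ltL_top.
by case=> [/h1|[[]|[[]|[[]|[[z /h1]|[[z /h1]|[z /h1]]]]]]].
Qed.

Lemma ltB_cases (x y : B) : ltB f x y -> ltB1 x y \/ y.2 = Ltop.
Proof.
by case=> [|[[]|[[]|[[]|[[z _ []]|[[z _ []]|[z _ []]]]]]]]; [left|right..].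
Qed.

Lemma ltB1_irr (x : B) : ~ ltB1 x x.
Proof.
have h y z : ltB1 y z -> ltL y.2 z.2 by case.
by move=> /h; rewrite /ltL eqxx.
Qed.

Lemma ltB_irr (x : B) : ~ ltB f x x.
Proof. by move=> xx; case: (ltB_cases xx) => [/ltB1_irr|/(ltB_ntop xx)]. Qed.

Lemma ltB1_trans (x y z : B) : ltB1 x y -> ltB1 y z -> ltB1 x z.
Proof.
case=> m n u v uv h.
have [w -> vw] : exists2 w, z = (m, n, w) & ltL v w.
  by inversion h; subst; eexists.
by constructor; apply: ltL_trans uv vw.
Qed.

Lemma ltB_trans (x y z : B) : ltB f x y -> ltB f y z -> ltB f x z.
Proof.
move=> xy yz; case: (ltB_cases xy) => [{}xy|/(ltB_ntop yz)//].
case: yz => [/(ltB1_trans xy)|[yz|[yz|[yz|[[w yw wz]|[[w yw wz]|[w yw wz]]]]]]].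
- by left.
- by do 4 right; left; exists y.
- by do 5 right; left; exists y.
- by do 6 right; exists y.
- by do 4 right; left; exists w => //; apply: ltB1_trans yw.
- by do 5 right; left; exists w => //; apply: ltB1_trans yw.
- by do 6 right; exists w => //; apply: ltB1_trans yw.
Qed.

HB.instance Definition _ := gen_eqMixin P2.
HB.instance Definition _ := gen_choiceMixin P2.

Definition ltPb : rel P2 := fun x y => `[< ltP x y >].

Lemma ltP1E (g : X i phi) (n k : nat) (y : P2) :
  ltP1 (P2X g n k) y -> exists2 m, n < m & y = P2X g m k.
Proof. by move=> h; inversion h; subst; eexists; first eassumption. Qed.

Lemma ltP1Er (g : X i phi) (n k : nat) (x : P2) :
  ltP1 x (P2X g n k) -> exists2 m, m < n & x = P2X g m k.
Proof. by move=> h; inversion h; subst; eexists; first eassumption. Qed.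

Lemma ltP3E (g : X i phi) (n k : nat) (y : P2) :
  ltP3 (P2X g n k) y -> y = P2B (sval g n, k, Ltop).
Proof. by move=> h; inversion h. Qed.

Lemma ltPXE (g : X i phi) (n k : nat) (x : P2) :
  ltP x (P2X g n k) -> ltP1 x (P2X g n k).
Proof. by case=> [//|[h|[h|[h|[w _ h]]]]]; inversion h. Qed.

Lemma ltPBE (b : B) (x : P2) : ltP x (P2B b) ->
  (exists2 a, ltB f a b & x = P2B a) \/
  exists g n k m, [/\ n <= m, x = P2X g n k & b = (sval g m, k, Ltop)].
Proof.
case=> [h|[h|[h|[h|[w h1 h2]]]]].
- by inversion h.
- by inversion h; subst; left; eexists; first eassumption.
- by inversion h; subst; right; do 4 eexists; split; first exact: leqnn.
- by inversion h.
- right; case: h1 h2 => g n m k nm /ltP3E [->].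
  by exists g, n, k, m; split=> //; apply: ltnW.
Qed.

Lemma ltPX_B (g : X i phi) (n k m : nat) :
  n <= m -> ltP (P2X g n k : P2) (P2B (sval g m, k, Ltop)).
Proof.
rewrite leq_eqVlt => /predU1P[->|nm]; first by do 2 right; left.
by do 4 right; exists (P2X g m k).
Qed.

Lemma ltP_ntop (x y : P2) : ltP x y -> x <> P2top.
Proof. by case=> [[]|[[]|[[]|[[]|[z []]]]]]. Qed.

Lemma ltP_top (x : P2) : x <> P2top -> ltP x P2top.
Proof. by move=> x0; do 3 right; left. Qed.

Lemma ltPb_irr : irreflexive ltPb.
Proof.
case=> [g n k|b|]; apply/asboolPn.
- by move=> /ltPXE/ltP1E[m nm [nE]]; rewrite nE ltnn in nm.
- by move=> /ltPBE[[a ab [aE]]|[? [? [? [? []]]]] //]; subst; apply: ltB_irr ab.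
- by move=> /ltP_ntop.
Qed.

Lemma ltPb_trans : transitive ltPb.
Proof.
move=> y x z /asboolP xy /asboolP yz; apply/asboolP.
case: z yz => [g m k|b|] yz; last exact/ltP_top/(ltP_ntop xy).
- have [n nm yE] := ltP1Er (ltPXE yz); subst y.
  have [p pn xE] := ltP1Er (ltPXE xy); subst x.
  by left; constructor; apply: ltn_trans nm.
- case/ltPBE: yz => [[c cb yE]|[g [n [k [m [nm yE bE]]]]]]; subst y.
    case/ltPBE: xy => [[a ac ->]|[g [n [k [m [_ _ cE]]]]]].
      by right; left; constructor; apply: ltB_trans cb.
    by subst c; have := ltB_ntop cb.
  have [p pn xE] := ltP1Er (ltPXE xy); subst x b.
  by apply: ltPX_B; apply: leq_trans nm; apply: ltnW.
Qed.

Fact P2_display : Order.disp_t. Proof. exact: (Order.Disp tt tt). Qed.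

HB.instance Definition _ := Order.Lt_isPOrder.Build P2_display P2
  ltPb_irr ltPb_trans.

Lemma ltP2E (x y : P2) : (x < y)%O <-> ltP x y.
Proof. by split=> [/asboolP|h]; last exact/asboolP. Qed.

Lemma leP2E (x y : P2) : (x <= y)%O <-> x = y \/ ltP x y.
Proof.
rewrite le_eqVlt; split=> [/predU1P[]|[->|/ltP2E ->]]; first by left.
- by move=> /ltP2E; right.
- by rewrite eqxx.
- by rewrite orbT.
Qed.

End P2order.

Lemma code_prefix (s t : seq nat) :
  prefix s t -> CodeSeq.code s <= CodeSeq.code t.
Proof.
elim: s t => [|x s IH] [|y t] //= /andP[/eqP-> /IH st].
by rewrite leq_mul2l ltnS leq_double st orbT.
Qed.

Lemma maps_exist : exists (i : ltpair -> set nat) (f : ltpair -> word -> nat),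
  [/\ injective i,
      forall p q, p <> q -> i p `&` i q = set0,
      forall p k, i p k -> psnd p < k &
      [/\ forall p s, i p (f p s),
          forall p (s t : word), word_le s t -> f p s <= f p t
        & forall p, injective (f p)]].
Proof.
pose f p (s : word) := CodeSeq.code [:: psnd p, pfst p & val s].
have fI p q s t : f p s = f q t -> p = q /\ s = t.
  move=> /(can_inj CodeSeq.codeK)[pq2 pq1 /val_inj->]; split=> //; apply: val_inj.
  by rewrite [LHS]surjective_pairing [RHS]surjective_pairing; congr pair.
exists (fun p => range (f p)), f; split.
- move=> p q pq; have: range (f p) (f p (word1 0)) by exists (word1 0).
  by rewrite pq => -[s _ /fI[]].
- move=> p q pq; rewrite -subset0 => k [[s _ <-] [t _ /esym/fI[]]] //.
- move=> p k [s _ <-]; rewrite /f /=.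
  apply: leq_trans (ltn_expl _ (ltnSn 1)) _.
  by rewrite leq_pmulr.
split.
- by move=> p s; exists s.
- by move=> p s t st; apply: code_prefix; rewrite /= !eqxx.
- by move=> p s t /fI[].
Qed.

Lemma phi_exists : exists phi : nat -> ltpair, bijective phi.
Proof.
have h : ([set: ltpair] #= [set: nat])%card.
  apply: eq_card_nat; first exact: countableP.
  move=> fin.
  have: infinite_set [set: nat] by exact: infinite_nat.
  apply; pose g (n : nat) : ltpair := exist _ (n, n.+1) (ltnSn n).
  rewrite -(preimage_setT g); apply: finite_preimage => //.
  by move=> x y _ _ [].
have /card_set_bijP[g] := h.
by rewrite setTT_bijective => -[phi gK phiK]; exists phi, g.
Qed.

(* Main.v *)
(* Let A be an irreducible closed set without top_2; we look for a greatest
   element. A maximal point of A that is no directed supremum from below is one,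
   because it can be split off; so suppose that A is generated by the points
   (m, k, top) in it. On each level k these meet only finitely many blocks E_n:
   otherwise a choice function g hitting infinitely many of them would put the
   whole chain (g, n, k), whose supremum is top_2, into A. Hence, if level k is
   unbounded, it has a point m larger than all pairs active at level k + 1, and
   above m only the tree relation sqsubset_4 matters: two children of m in A
   would give disjoint relatively open subtrees. So m has at most one child in
   A and can be split off. If all levels are bounded, any generator can be split
   off: a nontrivial chain converging to it has, by injectivity of f_{a,b}, only
   finitely many other generators above its elements, so it leaves their
   down-sets. *)
Require Import Defs.
From mathcomp Require Import all_boot all_order all_classical.
From mathcomp Require Import topology_structure separation_axioms.

Set Implicit Arguments.
Unset Strict Implicit.
Unset Printing Implicit Defensive.

Import Order.TTheory.
Local Open Scope classical_set_scope.

(** * Closed sets, closures and sobriety in Scott spaces *)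

Section ScottTopology.
Context {d : Order.disp_t} (P : porderType d).

Lemma Sigma_closedP (A : set (Sigma P)) : closed A <->
  (forall x y : P, A y -> (x <= y)%O -> A x) /\
  (forall (D : set P) (x : P),
     directed D -> supremums D x -> D `<=` A -> A x).
Proof.
rewrite -openC openSigmaE; split=> [[up sc]|[lo sc]]; split.
- by move=> x y Ay xy; apply: contrapT => nAx; apply: (up x y nAx xy).
- move=> D x dD Dx DA; apply: contrapT => nAx.
  by have [y [/DA Ay]] := sc D x dD Dx nAx.
- by move=> x y nAx xy Ay; apply: nAx; apply: lo xy.
- move=> D x dD Dx nAx; apply: contrapT => h; apply: nAx.
  apply: (sc D x dD Dx) => y Dy; apply: contrapT => nAy.
  by apply: h; exists y.
Qed.

Lemma Sigma_closed_down (x : P) : closed ([set y | (y <= x)%O] : set (Sigma P)).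
Proof.
apply/Sigma_closedP; split=> [y z /= zx yz|D y _ [_ lub] Dx].
  exact: le_trans zx.
exact: lub.
Qed.

Lemma Sigma_closure1 (x : P) :
  closure ([set x] : set (Sigma P)) = [set y | (y <= x)%O].
Proof.
rewrite eqEsubset; split.
  rewrite closureE; apply: smallest_sub; first exact: Sigma_closed_down.
  by move=> _ ->; apply: lexx.
move=> y yx.
have /Sigma_closedP[lo _] := @closed_closure (Sigma P) [set x].
by apply: (lo y x) yx; apply: subset_closure.
Qed.

Lemma Sigma_kolmogorov : kolmogorov_space (Sigma P).
Proof.
have sep (x y : P) : ~ (x <= y)%O ->
    (~` [set z : P | (z <= y)%O] : set (Sigma P)) \in nbhs (x : Sigma P).
  move=> xy; rewrite inE; apply: open_nbhs_nbhs; split=> //.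
  by rewrite openC; apply: Sigma_closed_down.
move=> x y /eqP xy; have [xley|] := pselect ((x : P) <= y)%O.
  exists (~` [set z : P | (z <= x)%O]); right; split.
    by apply: sep => yx; apply: xy; apply: le_anti; rewrite xley yx.
  by rewrite inE setCK /=.
move=> nxy; exists (~` [set z : P | (z <= y)%O]); left; split; first exact: sep.
by rewrite inE setCK /=.
Qed.

(** Closed sets are lower sets, so a greatest element [x] of [A] makes [A] the down-set of [x],
    which is its closure; uniqueness is antisymmetry. *)
Lemma Sigma_sober : (forall A : set (Sigma P), A !=set0 -> closed A ->
    irreducible A -> exists2 x : P, A x & forall y : P, A y -> (y <= x)%O) ->
  sober (Sigma P).
Proof.
move=> gtst; split=> [|A A0 cA iA]; first exact: Sigma_kolmogorov.
have [x Ax xmax] := gtst A A0 cA iA.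
exists x; split=> [|y].
  rewrite Sigma_closure1 eqEsubset; split=> // y yx.
  by apply: ((Sigma_closedP A).1 cA).1 yx.
rewrite Sigma_closure1 => AE; apply: le_anti; apply/andP; split.
  by have : A x by []; rewrite AE.
by apply: xmax; rewrite AE /=.
Qed.

(* A maximal point that is reached by no directed set from below can be cut
   off from a closed set. *)
Lemma irreducible_greatest (A : set (Sigma P)) (x : P) :
    closed A -> irreducible A -> A x ->
    (forall y : P, A y -> (x <= y)%O -> y = x) ->
    (forall D : set P, directed D -> supremums D x -> D x) ->
  forall y : P, A y -> (y <= x)%O.
Proof.
move=> cA iA Ax xmax xcpt; have [lo sc] := (Sigma_closedP A).1 cA.
case: (iA [set y : P | (y <= x)%O] (A `\ (x : Sigma P))).
- exact: Sigma_closed_down.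
- apply/Sigma_closedP; split=> [y z [Az zx] yz|D y dD Dy DA].
    split; first exact: lo yz.
    by move=> yx; apply: zx; apply: xmax => //; rewrite -[X in (X <= _)%O]yx.
  split; first by apply: sc dD Dy _ => z /DA[].
  by move=> /= yx; rewrite yx in Dy; have [_ /(_ erefl)] := DA _ (xcpt D dD Dy).
- move=> y Ay; have [->|yx] := pselect (y = x); first by left; apply: lexx.
  by right.
- by [].
- by move=> /(_ x Ax)[_ /(_ erefl)].
Qed.

End ScottTopology.

(** * Numerical ranks on [M] and on words *)

Definition rank (y : M) : nat :=
  match y with inl n => n | inr s => size (val s) end.

(** Dominates both kinds of rank below an edge: the length handles the words of [ltB2], the sum of
    letters the numbers of [ltB3] and [ltB4]. *)
Definition weight (s : word) : nat := size (val s) + sumn (val s).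

Lemma leM_refl : reflexive leM.
Proof. by case=> [n|s] /=; rewrite ?leqnn // /word_le prefix_refl. Qed.

Lemma leM_lt_rank (y z : M) : leM y z -> y <> z -> rank y < rank z.
Proof.
case: y z => [a|s] [b|t] //=.
  by rewrite leq_eqVlt => /predU1P[->|].
move=> /prefixP[[|x u] tE] st; last by rewrite tE size_cat /= addnS ltnS leq_addr.
by case: st; congr inr; apply: val_inj; rewrite tE cats0.
Qed.

Lemma leM_rank (y z : M) : leM y z -> rank y <= rank z.
Proof.
by have [->//|yz h] := pselect (y = z); apply/ltnW/leM_lt_rank.
Qed.

Lemma rank_weight (s : word) : rank (inr s) <= weight s.
Proof. exact: leq_addr. Qed.

Lemma weight_rcons (s : word) (x : nat) : x <= weight (word_rcons s x).
Proof. by rewrite /weight /= -cats1 sumn_cat /= addn0 addnA leq_addl. Qed.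

Lemma prefix_rcons2 (s : seq nat) (x y : nat) (t : seq nat) :
  prefix (rcons s x) t -> prefix (rcons s y) t -> x = y.
Proof.
move=> /prefixP[u ->] /prefixP[v]; rewrite -!cats1 -!catA => /eqP.
by rewrite eqseq_cat // => /andP[_ /eqP[]].
Qed.

(* An element (m, k, y_p) lies below (f p s, k', top) only along such an edge,
   and then rank y <= weight s: unless a directed set contains its supremum, the
   points above it escape along words of unbounded weight. *)
Definition edge (f : ltpair -> word -> nat) (p : ltpair) (m k : nat) (s : word)
    (k' : nat) : Prop :=
  (k' = k.+1 /\ (m = pfst p \/ m = psnd p)) \/
  (k' = k /\ exists t x, m = f p t /\ s = word_rcons t x).

(** * Up-sets and down-sets of points of [P2] *)

Section Structure.
Variables (i : ltpair -> set nat) (f : ltpair -> word -> nat).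
Variable phi : nat -> ltpair.
Local Notation P := (P2 i f phi).
Local Notation top m k := (P2B (m, k, Ltop) : P).
Local Notation lat m k p y := (P2B (m, k, Lat p y) : P).

Lemma ltB1_latE (m k : nat) (p : ltpair) (y : M) (b : B) :
  ltB1 (m, k, Lat p y) b -> b = (m, k, Ltop) \/
  exists z, [/\ b = (m, k, Lat p z), leM y z & y <> z].
Proof.
move=> h; inversion h as [m' k' u v uv]; subst; case: v uv {h} => [[q z]|]; last by left.
rewrite /ltL /= => /andP[yz /andP[/eqP pq le]]; subst q; right; exists z; split=> //.
by move=> yzE; subst z; rewrite eqxx in yz.
Qed.

Lemma ltB234_latE (m k : nat) (p : ltpair) (y : M) (b : B) :
  [\/ ltB2 f (m, k, Lat p y) b, ltB3 f (m, k, Lat p y) b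
    | ltB4 f (m, k, Lat p y) b] ->
  exists s k', [/\ b = (f p s, k', Ltop), edge f p m k s k' & rank y <= weight s].
Proof.
case=> h.
- inversion h; subst; exists x, k.+1; split=> //; last exact: rank_weight.
  by left; split=> //; left.
- inversion h; subst; exists (word1 x), k.+1; split=> //.
    by left; split=> //; right.
  by rewrite /weight /= addn0 add1n.
- inversion h; subst; exists (word_rcons s x), k; split=> //.
    by right; split=> //; exists s, x.
  exact: weight_rcons.
Qed.

Lemma lat_leE (m k : nat) (p : ltpair) (y : M) (z : P) :
  (lat m k p y <= z)%O ->
  [\/ z = P2top, z = top m k, exists2 y', z = lat m k p y' & leM y y'
    | exists s k', [/\ z = top (f p s) k', edge f p m k s k'
                     & rank y <= weight s]].
Proof.
case: z => [g n k'|b|] /leP2E[|lt]; try by constructor 1.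
- by have [] := ltP1Er (ltPXE lt).
- by move=> [<-]; constructor 3; exists y => //; apply: leM_refl.
have [[a ab [aE]]|[? [? [? [? []]]]] //] := ltPBE lt; subst a.
(* A composite relation first climbs inside the copy of [M], which only raises the rank, so the
   bound at [w] passes down to [y]. *)
have comp (w : B) : ltB1 (m, k, Lat p y) w ->
    [\/ ltB2 f w b, ltB3 f w b | ltB4 f w b] ->
    exists s k', [/\ P2B b = top (f p s) k', edge f p m k s k'
                      & rank y <= weight s].
  move=> /ltB1_latE[->|[y' [-> yy' _]]].
    by case=> h; inversion h.
  move=> /ltB234_latE[s [k' [-> e r]]]; exists s, k'; split=> //.
  exact: leq_trans (leM_rank yy') r.
have dir : [\/ ltB2 f (m, k, Lat p y) b, ltB3 f (m, k, Lat p y) b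
    | ltB4 f (m, k, Lat p y) b] ->
    exists s k', [/\ P2B b = top (f p s) k', edge f p m k s k'
                      & rank y <= weight s].
  by move=> /ltB234_latE[s [k' [-> ? ?]]]; exists s, k'.
case: ab => [/ltB1_latE[->|[y' [-> yy' _]]]|ab]; first by constructor 2.
  by constructor 3; exists y'.
constructor 4; case: ab => [h|[h|[h|[[w ? ?]|[[w ? ?]|[w ? ?]]]]]].
- by apply: dir; constructor 1.
- by apply: dir; constructor 2.
- by apply: dir; constructor 3.
- by apply: (comp w) => //; constructor 1.
- by apply: (comp w) => //; constructor 2.
- by apply: (comp w) => //; constructor 3.
Qed.

Lemma le_latE (m k : nat) (p : ltpair) (y : M) (z : P) :
  (z <= lat m k p y)%O -> exists2 y', z = lat m k p y' & leM y' y.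
Proof.
have [->|nz] := pselect (z = lat m k p y).
  by move=> _; exists y => //; apply: leM_refl.
move=> /leP2E[//|/ltPBE[[[[m' k'] u] ab ->]|[? [? [? [? [_ _ []]]]]] //]].
case: (ltB_cases ab) => // h; inversion h as [? ? v w uv]; subst.
by case: u uv {ab h nz} => [[q y']|] // /andP[_ /andP[/eqP -> yy']]; exists y'.
Qed.

Lemma lat_le_top (m k : nat) (p : ltpair) (y : M) : (lat m k p y <= top m k)%O.
Proof. by apply/leP2E; right; right; left; constructor; left; constructor. Qed.

Lemma le_P2top (z : P) : (z <= P2top)%O.
Proof.
by apply/leP2E; have [->|nz] := pselect (z = P2top); [left|right; apply: ltP_top].
Qed.

Lemma P2top_leE (z : P) : (P2top <= z)%O -> z = P2top.
Proof. by move=> zt; apply: le_anti; rewrite le_P2top zt. Qed.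

Lemma top_leE (m k : nat) (z : P) : (top m k <= z)%O -> z = top m k \/ z = P2top.
Proof.
case: z => [g n k'|b|] /leP2E[|lt]; try by right.
- by have [] := ltP1Er (ltPXE lt).
- by move=> ->; left.
have [[a ab [aE]]|[? [? [? [? []]]]] //] := ltPBE lt; subst a.
by have := ltB_ntop ab.
Qed.

Lemma X_leE (g : X i phi) (n k : nat) (z : P) : (P2X g n k <= z)%O ->
  [\/ z = P2top, exists2 n', z = P2X g n' k & n <= n'
    | exists2 n', z = top (sval g n') k & n <= n'].
Proof.
case: z => [g' n' k'|b|] /leP2E[|lt]; try by constructor 1.
- by move=> [<- <- <-]; constructor 2; exists n.
- by have [n0 ? [-> -> ->]] := ltP1Er (ltPXE lt); constructor 2; exists n' => //; apply: ltnW.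
have [[a ab [aE]] //|[g' [n' [k' [n0 [? [-> -> ->] ->]]]]]] := ltPBE lt.
by constructor 3; exists n0.
Qed.

Lemma X_le_X (g : X i phi) (n n' k : nat) :
  n <= n' -> (P2X g n k <= P2X g n' k :> P)%O.
Proof.
rewrite leq_eqVlt => /predU1P[->|nn']; first exact: lexx.
by apply/leP2E; right; left; constructor.
Qed.

Lemma X_le_top (g : X i phi) (n n' k : nat) :
  n <= n' -> (P2X g n k <= top (sval g n') k)%O.
Proof. by move=> nn'; apply/leP2E; right; apply: ltPX_B. Qed.

End Structure.

(** * Directed suprema in [P2] *)

Section Sobriety.
Variables (i : ltpair -> set nat) (f : ltpair -> word -> nat).
Variable phi : nat -> ltpair.
Hypothesis i_disj : forall p q : ltpair, p <> q -> i p `&` i q = set0.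
Hypothesis i_gt : forall (p : ltpair) (k : nat), i p k -> psnd p < k.
Hypothesis f_mem : forall (p : ltpair) (s : word), i p (f p s).
Hypothesis f_mono : forall (p : ltpair) (s t : word), word_le s t -> f p s <= f p t.
Hypothesis f_inj : forall p : ltpair, injective (f p).
Hypothesis phi_bij : bijective phi.
Local Notation P := (P2 i f phi).
Local Notation top m k := (P2B (m, k, Ltop) : P).
Local Notation lat m k p y := (P2B (m, k, Lat p y) : P).

Lemma i_eq (p q : ltpair) (m : nat) : i p m -> i q m -> p = q.
Proof.
move=> ipm iqm; apply: contrapT => /i_disj E0.
by have : (i p `&` i q) m by []; rewrite E0.
Qed.

Lemma f_eq (p q : ltpair) (s t : word) : f p s = f q t -> p = q /\ s = t.
Proof.
move=> E0; have pq : p = q by apply: (@i_eq p q (f p s)) => //; rewrite E0.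
by split=> //; subst q; apply: f_inj E0.
Qed.

Lemma X_inj (g : X i phi) (n n' : nat) : sval g n = sval g n' -> n = n'.
Proof.
move=> E0; apply: (bij_inj phi_bij); apply: (@i_eq _ _ (sval g n)).
  exact: (svalP g n).
by rewrite E0; apply: (svalP g n').
Qed.

(** The values of [g] lie in disjoint blocks, hence are distinct, so each [top (sval g n) k] is
    above only an initial part of the chain. *)
Lemma X_ub (g : X i phi) (k : nat) (z : P) :
  (forall n, exists2 n', n <= n' & (P2X g n' k <= z)%O) -> z = P2top.
Proof.
move=> zub; have {}zub n : (P2X g n k <= z)%O.
  by have [n' nn' ?] := zub n; apply: le_trans (X_le_X _ _ _ nn') _.
have [//|[n zE _]|[n zE _]] := X_leE (zub 0); have := X_leE (zub n.+1).
  by rewrite zE => -[//|[n' [->]]|[n' []]] //; rewrite ltnn.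
by rewrite zE => -[//|[n' []]|[n' [/X_inj->]]] //; rewrite ltnn.
Qed.

(** If [D] omits its supremum, it has no maximal element. So it contains no [top m k], and one point
    of a chain [P2X g n k] would bring in cofinally many and force [x] to be [P2top]. What remains
    is one copy of [M], where strict steps raise the rank. *)
Lemma directed_sup (D : set P) (x : P) :
  directed D -> supremums D x -> x <> P2top -> D x \/
  exists m k p, [/\ x = top m k, forall z, D z -> exists y, z = lat m k p y
                  & forall r, exists2 y, r <= rank y & D (lat m k p y)].
Proof.
move=> [[d0 Dd0] dD] [ub lub] xtop; have [|nDx] := pselect (D x); [by left|right].
have up z : D z -> exists z', [/\ D z', (z <= z')%O & z <> z'].
  move=> Dz; apply: contrapT => nz; apply: nDx.
  suff -> : x = z by [].
  apply: le_anti; apply/andP; split; last exact: ub.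
  apply: lub => w Dw; have [t [Dt zt wt]] := dD z w Dz Dw.
  have [->//|nzt] := pselect (z = t).
  by case: nz; exists t.
have ntop m k : ~ D (top m k).
  move=> /up[z [Dz /top_leE[->|zE] ne]]; first by [].
  by apply: xtop; apply: P2top_leE; rewrite -zE; apply: ub.
have nP2top : ~ D P2top by move=> /ub/P2top_leE.
have nX g n k : ~ D (P2X g n k).
  move=> Dg; apply: xtop; apply: (@X_ub g k) => n0.
  suff: exists2 n', n0 <= n' & D (P2X g n' k).
    by move=> [n' ? Dn']; exists n' => //; apply: ub.
  elim: n0 => [|n0 [n' nn' Dn']]; first by exists n.
  have [z [Dz]] := up _ Dn'.
  move=> /X_leE[zE|[n1 zE le1] ne|[n1 zE _]]; rewrite zE in Dz => //; last first.
    by have := ntop _ _ Dz.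
  exists n1 => //; apply: leq_ltn_trans nn' _; rewrite ltn_neqAle le1 andbT.
  by apply/eqP => E0; apply: ne; rewrite zE E0.
case: d0 Dd0 => [g n k /nX//|[[m k] [[p y0]|]]|/nP2top//] Dd0; last first.
  by have := ntop _ _ Dd0.
have Dlat z : D z -> exists y, z = lat m k p y.
  move=> Dz; have [t [Dt]] := dD _ _ Dd0 Dz.
  move=> /lat_leE[tE|tE|[y tE _]|[s [k' [tE _ _]]]]; subst t => //.
  - by have := ntop _ _ Dt.
  - by move=> /le_latE[y' ->]; exists y'.
  - by have := ntop _ _ Dt.
have unb r : exists2 y, r <= rank y & D (lat m k p y).
  elim: r => [|r [y ry Dy]]; first by exists y0.
  have [z [Dz]] := up _ Dy; have [y' zE] := Dlat _ Dz; subst z.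
  move=> /le_latE[y1 [E1] le1] ne; subst y1; exists y' => //.
  by apply: leq_ltn_trans ry _; apply: leM_lt_rank le1 _ => E1; apply: ne; rewrite E1.
exists m, k, p; split=> //.
(* Being below [top m k], the supremum is no other generator, and the unbounded ranks keep it out of
   the copy of [M]. *)
have xle : (x <= top m k)%O.
  by apply: lub => z /Dlat[y ->]; apply: lat_le_top.
have /lat_leE[//|//|[y xE _]|[s [k' [xE _ _]]]] := ub _ Dd0.
  have [y' ry Dy'] := unb (rank y).+1.
  have := ub _ Dy'; rewrite xE => /le_latE[y1 [<-] /leM_rank]; by rewrite leqNgt ry.
by move: xle; rewrite xE => /top_leE[].
Qed.

(** An upper bound [top (f p s) k'] different from [top m k] is above elements of this copy of rank
    at most [weight s] only, since [f p s] determines [s]. *)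
Lemma sup_lat (D : set P) (m k : nat) (p : ltpair) :
    (forall z, D z -> exists y, z = lat m k p y) ->
    (forall r, exists2 y, r <= rank y & D (lat m k p y)) ->
  supremums D (top m k).
Proof.
move=> Dlat unb; split=> [z /Dlat[y ->]|z ub]; first exact: lat_le_top.
have [y0 _ Dy0] := unb 0.
have [->|->|[y zE _]|[s [k' [zE _ _]]]] := lat_leE (ub _ Dy0).
- exact: le_P2top.
- exact: lexx.
- have [y' ry /ub] := unb (rank y).+1.
  by rewrite zE => /le_latE[y1 [<-] /leM_rank]; rewrite leqNgt ry.
have [y' ry /ub] := unb (weight s).+1.
rewrite zE => /lat_leE[//|[-> ->]|[]//|[s' [k1 [[E1 _] _ rs]]]]; first exact: lexx.
by move: rs; rewrite leqNgt -(f_eq E1).2 ry.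
Qed.

(** By injectivity each value is taken by at most one word, so only finitely many words matter. *)
Lemma weight_bound (p : ltpair) (N : nat) :
  exists r, forall s, f p s <= N -> weight s <= r.
Proof.
have step N' r : (forall s, f p s < N' -> weight s <= r) ->
    exists r', forall s, f p s <= N' -> weight s <= r'.
  move=> hr; have [[t tN]|nt] := pselect (exists t, f p t = N'); last first.
    exists r => s; rewrite leq_eqVlt => /predU1P[sN|/hr//].
    by case: nt; exists s.
  exists (maxn (weight t) r) => s; rewrite leq_eqVlt leq_max.
  case/predU1P=> [sN|/hr->]; last exact: orbT.
  by rewrite (f_inj (etrans sN (esym tN))) leqnn.
elim: N => [|N [r hr]]; first exact: (@step 0 0).
exact: (@step N.+1 r).
Qed.

(** * An irreducible closed set without greatest element *)

Section IrreducibleClosed.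
Variable A : set (Sigma P).
Hypotheses (cA : closed A) (iA : irreducible A).
Hypothesis A_P2top : ~ A (P2top : P).
Hypothesis A_nogreatest : forall x : P, A x -> ~ forall y : P, A y -> (y <= x)%O.

Lemma A_lower (x y : P) : A y -> (x <= y)%O -> A x.
Proof. exact: ((Sigma_closedP A).1 cA).1. Qed.

Lemma A_sup (D : set P) (x : P) :
  directed D -> supremums D x -> D `<=` A -> A x.
Proof. exact: ((Sigma_closedP A).1 cA).2. Qed.

(** By [directed_sup] such an [x] belongs to every directed set with supremum [x]; were it maximal,
    [irreducible_greatest] would make it greatest. *)
Lemma A_not_maximal (x : P) : A x -> (forall m k, x <> top m k) ->
  exists y : P, [/\ A y, (x <= y)%O & x <> y].
Proof.
move=> Ax ntop; apply: contrapT => xmax; apply: (A_nogreatest Ax).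
apply: (irreducible_greatest cA iA Ax) => [y Ay xy|D dD Dx].
  by apply: contrapT => yx; apply: xmax; exists y; split=> // xE; apply: yx.
have xtop : x <> P2top by move=> xE; apply: A_P2top; rewrite -xE.
by have [//|[m [k [p [/ntop]]]]] := directed_sup dD Dx xtop.
Qed.

Lemma A_chain (g : X i phi) (k : nat) :
  exists n, ~ A (P2X g n k : P).
Proof.
apply: contrapT => nA; have gA n : A (P2X g n k : P).
  by apply: contrapT => ?; apply: nA; exists n.
apply: A_P2top; apply: (@A_sup (range (fun n => P2X g n k))).
- split; first by exists (P2X g 0 k), 0.
  move=> _ _ [n _ <-] [n' _ <-]; exists (P2X g (maxn n n') k); split.
  + by exists (maxn n n').
  + by apply: X_le_X; rewrite leq_maxl.
  + by apply: X_le_X; rewrite leq_maxr.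
- split=> [z _|z ub]; first exact: le_P2top.
  have -> : z = P2top by apply: (@X_ub g k) => n; exists n => //; apply: ub; exists n.
  exact: lexx.
- by move=> _ [n _ <-].
Qed.

(** Otherwise [A_not_maximal] raises [x] strictly without end: in a chain [P2X g n k] this
    contradicts [A_chain], and in a copy of [M] the resulting sequence has supremum [top m k], which
    is then in [A]. *)
Lemma A_below_top (x : P) : A x ->
  exists m k, A (top m k) /\ (x <= top m k)%O.
Proof.
case: x => [g n k|[[m k] [[p y0]|]]|//] Ax.
- apply: contrapT => nx; have [N] := A_chain g k; apply.
  suff: exists2 n', N <= n' & A (P2X g n' k : P).
    by move=> [n' Nn' An']; apply: A_lower An' (X_le_X _ _ _ Nn').
  suff: exists n', [/\ N <= n', n <= n' & A (P2X g n' k : P)].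
    by move=> [n' [? _ ?]]; exists n'.
  elim: N => [|N [n' [Nn' nn' An']]]; first by exists n.
  have [|z [Az]] := A_not_maximal An'; first by [].
  move=> /X_leE[zE|[n1 zE le1] ne|[n1 zE le1] _]; subst z => //; last first.
    by case: nx; exists (sval g n1), k; split=> //; apply: X_le_top; apply: leq_trans le1.
  have lt1 : n' < n1.
    by rewrite ltn_neqAle le1 andbT; apply/eqP => E1; apply: ne; rewrite E1.
  exists n1; split=> //; first exact: leq_ltn_trans Nn' lt1.
  exact: leq_trans nn' le1.
- apply: contrapT => nx.
  pose Q y := A (lat m k p y) /\ (lat m k p y0 <= lat m k p y)%O.
  have nextP (y : {y | Q y}) : exists z : {z | Q z},
      (lat m k p (sval y) <= lat m k p (sval z))%O /\ rank (sval y) < rank (sval z).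
    case: y => y [Ay y0y] /=; have [|z [Az]] := A_not_maximal Ay; first by [].
    move=> /[dup] yz /lat_leE[zE|zE|[z' zE le1]|[s [k' [zE _ _]]]] ne; subst z => //.
    + by case: nx; exists m, k; split=> //; apply: lat_le_top.
    + exists (exist Q z' (conj Az (le_trans y0y yz))); split=> //=.
      by apply: leM_lt_rank le1 _ => E1; apply: ne; rewrite E1.
    + by case: nx; exists (f p s), k'; split=> //; apply: le_trans yz.
  have [next hnext] := choice nextP.
  pose c n := iter n next (exist Q y0 (conj Ax (lexx _))).
  have c_mono n n' : n <= n' -> (lat m k p (sval (c n)) <= lat m k p (sval (c n')))%O.
    elim: n' => [|n' IH]; first by rewrite leqn0 => /eqP->; apply: lexx.
    rewrite leq_eqVlt => /predU1P[->|/IH nn']; first exact: lexx.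
    by apply: le_trans nn' _; have [] := hnext (c n').
  have c_rank n : n <= rank (sval (c n)).
    by elim: n => // n IH; apply: leq_ltn_trans IH _; have [] := hnext (c n).
  case: nx; exists m, k; split; last exact: lat_le_top.
  apply: (@A_sup (range (fun n => lat m k p (sval (c n))))).
  + split; first by exists (lat m k p (sval (c 0))), 0.
    move=> _ _ [n _ <-] [n' _ <-]; exists (lat m k p (sval (c (maxn n n')))); split.
    * by exists (maxn n n').
    * by apply: c_mono; rewrite leq_maxl.
    * by apply: c_mono; rewrite leq_maxr.
  + apply: (@sup_lat _ _ _ p) => [_ [n _ <-]|r]; first by exists (sval (c n)).
    by exists (sval (c r)) => //; exists r.
  + by move=> _ [n _ <-]; have [] := svalP (c n).
- by exists m, k; split=> //; apply: lexx.
Qed.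

Lemma A_finite_blocks (k : nat) :
  exists N, forall n m, A (top m k) -> E i phi n m -> n < N.
Proof.
apply: contrapT => nN.
have act N : exists n m, [/\ N <= n, A (top m k) & E i phi n m].
  apply: contrapT => h; apply: nN; exists N => n m Am Em.
  by rewrite ltnNge; apply/negP => Nn; apply: h; exists n, m.
(* Choose a point active in [A] whenever block [n] has one; otherwise any element of the block
   serves as default. *)
have gP n : exists m, E i phi n m /\ ((exists2 m', A (top m' k) & E i phi n m') -> A (top m k)).
  have [[m Am Em]|nm] := pselect (exists2 m', A (top m' k) & E i phi n m').
    by exists m.
  by exists (f (phi n) (word1 0)); split=> //; apply: f_mem.
have [g hg] := choice gP.
pose gX : X i phi := exist _ g (fun n => (hg n).1).
have [n nA] := A_chain gX k; apply: nA.
have [n' [m [nn' Am Em]]] := act n.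
by apply: A_lower (X_le_top f gX k nn'); apply: (hg n').2; exists m.
Qed.

Lemma A_bounded_pairs (k : nat) :
  exists N, forall p s, A (top (f p s) k) -> psnd p <= N.
Proof.
have [N hN] := A_finite_blocks k.
exists (\max_(n < N) psnd (phi n)) => p s As.
have [phi' _ phiK] := phi_bij.
have nN : phi' p < N by apply: hN As _; rewrite /E phiK.
by rewrite -{1}[p]phiK; apply: (leq_bigmax (Ordinal nN)).
Qed.

(* [W] is open among the pairs (m, k) with (m, k, top) in A, in the topology
   induced by A. *)
Definition open_tops (W : nat -> nat -> Prop) : Prop :=
  forall m k, A (top m k) -> W m k -> forall p, exists r, forall s k',
    edge f p m k s k' -> A (top (f p s) k') -> ~ W (f p s) k' -> weight s <= r.

Definition down_off (W : nat -> nat -> Prop) : set (Sigma P) :=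
  [set z : P | exists m k, [/\ A (top m k), ~ W m k & (z <= top m k)%O]].

(** A new supremum is some [top m k] approached with unbounded rank in one copy of [M]. If it is in
    [W], its approximants lie below generators off [W], reached by edges whose weights openness
    bounds. *)
Lemma closed_down_off (W : nat -> nat -> Prop) :
  open_tops W -> closed (down_off W).
Proof.
move=> oW; apply/Sigma_closedP; split=> [x y [m [k [Am nW ym]]] xy|D x dD Dx DW].
  by exists m, k; split=> //; apply: le_trans ym.
have Ax : A x.
  by apply: (A_sup dD Dx) => z /DW[m [k [Am _ zm]]]; apply: A_lower zm.
have xtop : x <> P2top by move=> xE; apply: A_P2top; rewrite -xE.
have [/DW//|[m [k [p [xE Dlat unb]]]]] := directed_sup dD Dx xtop.
subst x; have [Wm|nWm] := pselect (W m k); last first.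
  by exists m, k; split=> //; apply: lexx.
have [r hr] := oW m k Ax Wm p; have [y ry /DW[m' [k' [Am' nW]]]] := unb r.+1.
move=> /lat_leE[//|[mE kE]|[]//|[s [k1 [[mE kE] e ys]]]].
  by case: nW; rewrite mE kE.
rewrite mE kE in Am' nW; have := leq_trans ry ys.
by rewrite ltnNge (hr s k1).
Qed.

(** If [W1] and [W2] were disjoint, the closed sets [down_off W1] and [down_off W2] would cover [A],
    yet each misses a point of it. *)
Lemma open_tops_meet (W1 W2 : nat -> nat -> Prop) (m1 k1 m2 k2 : nat) :
    open_tops W1 -> open_tops W2 -> A (top m1 k1) -> W1 m1 k1 ->
    A (top m2 k2) -> W2 m2 k2 ->
  exists m k, W1 m k /\ W2 m k.
Proof.
move=> o1 o2 A1 W11 A2 W22; apply: contrapT => disj.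
have absurd W m k : A (top m k) -> W m k -> ~ A `<=` down_off W.
  move=> Am Wm /(_ _ Am)[m' [k' [_ nW /top_leE[[mE kE]|//]]]].
  by apply: nW; rewrite mE kE.
have cover : A `<=` down_off W1 `|` down_off W2.
  move=> x /A_below_top[m [k [Am xm]]].
  have [W1m|nW1] := pselect (W1 m k); [right|left]; exists m, k; split=> // W2m.
  by apply: disj; exists m, k.
case: (iA (closed_down_off o1) (closed_down_off o2) cover).
  exact: absurd A1 W11.
exact: absurd A2 W22.
Qed.

(** Otherwise [A] splits into the down-set of [top m k] and the closed set generated by the other
    generators. *)
Lemma not_open_singleton (m k : nat) :
  A (top m k) -> ~ open_tops (fun m' k' => m' = m /\ k' = k).
Proof.
set W := fun m' k' => _; move=> Am oW; apply: (A_nogreatest Am).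
have cC := @Sigma_closed_down _ P (top m k).
case: (iA cC (closed_down_off oW)) => [x||/(_ _ Am)[m' [k' [_ nW]]]] //.
  move=> /A_below_top[m' [k' [Am' xm]]].
  have [[mE kE]|nW] := pselect (W m' k'); last by right; exists m', k'.
  by left; rewrite mE kE in xm.
by move=> /top_leE[[mE kE]|//]; case: nW.
Qed.

Lemma A_unbounded_level (m k : nat) : A (top m k) ->
  exists k', forall N, exists2 m', N < m' & A (top m' k').
Proof.
move=> Am; apply: contrapT => nunb.
have bnd k' : exists N, forall m', A (top m' k') -> m' <= N.
  apply: contrapT => nN; apply: nunb; exists k' => N; apply: contrapT => nm.
  apply: nN; exists N => m' Am'; rewrite leqNgt; apply/negP => Nm'.
  by apply: nm; exists m'.
apply: (not_open_singleton Am) => m0 k0 _ [-> ->] p.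
(* Edges leaving level [k] end on level [k] or [k.+1], so these two bounds suffice. *)
have [N1 h1] := bnd k; have [N2 h2] := bnd k.+1.
have [r hr] := weight_bound p (maxn N1 N2); exists r => s k' e As _; apply: hr.
by rewrite leq_max; case: e As => [[-> _] /h2->|[-> _] /h1->]; rewrite ?orbT.
Qed.

(* The pairs active at level k + 1 being bounded by N, every edge leaving a
   point m > N of level k stays on that level and extends a word, so that the
   words extending a fixed one form an open set. *)
Lemma A_no_large_top (N m k : nat) :
    (forall p s, A (top (f p s) k.+1) -> psnd p <= N) ->
  N < m -> ~ A (top m k).
Proof.
move=> hN Nm Am.
have level m' p s k' : m <= m' -> edge f p m' k s k' -> A (top (f p s) k') ->
    k' = k /\ exists t x, m' = f p t /\ s = word_rcons t x.
  (* An edge to level [k.+1] starts at a component of an active pair, which is at most [N]. *)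
  move=> mm' [[-> mE] /hN pN|//]; exfalso.
  have : m' <= psnd p by case: mE => -> //; apply/ltnW/(valP p).
  by rewrite leqNgt (leq_ltn_trans pN) // (leq_trans Nm).
pose cone p t m' k' := k' = k /\ exists2 s, word_le t s & m' = f p s.
have open_cone p t : m <= f p t -> open_tops (cone p t).
  (* No edge to a generator in [A] leaves the cone, so any bound does. *)
  move=> mt m1 k1 _ [-> [s ts ->]] q; exists 0 => s' k' e As' nW; exfalso.
  have [kE [t' [x [E1 s'E]]]] := level _ _ _ _ (leq_trans mt (f_mono p ts)) e As'.
  have [pq st'] := f_eq E1; apply: nW; split=> //; exists s'; last by rewrite pq.
  by apply: prefix_trans ts _; rewrite s'E st' /= prefix_rcons.
have uniq_child p s x y : m = f p s -> A (top (f p (word_rcons s x)) k) ->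
    A (top (f p (word_rcons s y)) k) -> x = y.
  move=> mE Ax Ay.
  have oc z : open_tops (cone p (word_rcons s z)).
    by apply: open_cone; rewrite mE; apply: f_mono; apply: prefix_rcons.
  have inc z : cone p (word_rcons s z) (f p (word_rcons s z)) k.
    by split=> //; exists (word_rcons s z) => //; apply: prefix_refl.
  (* A common point of the two cones comes from one word having both children as prefixes. *)
  have [m' [k' [[_ [u xu m'E]] [_ [v yv m'E']]]]] :=
    open_tops_meet (oc x) (oc y) Ax (inc x) Ay (inc y).
  move: (f_inj (etrans (esym m'E) m'E')) => uv; subst v.
  exact: prefix_rcons2 xu yv.
(* With at most one child in [A], the point [m] alone is open: the bound is the weight of that
   child, or arbitrary if there is none. *)
apply: (not_open_singleton Am) => m0 k0 _ [-> ->] p.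
have [[t [x [mE Ax]]]|none] :=
  pselect (exists t x, m = f p t /\ A (top (f p (word_rcons t x)) k)).
  exists (weight (word_rcons t x)) => s k' e As _.
  have [kE [t' [x' [mE' sE]]]] := level _ _ _ _ (leqnn m) e As.
  move: (f_inj (etrans (esym mE') mE)) => tt'; subst t' s k'.
  by rewrite (uniq_child _ _ _ _ mE As Ax).
exists 0 => s k' e As _; exfalso.
have [kE [t' [x' [mE' sE]]]] := level _ _ _ _ (leqnn m) e As.
by apply: none; exists t', x'; subst s k'.
Qed.

End IrreducibleClosed.

Lemma P2_sober : sober (Sigma P).
Proof.
apply: Sigma_sober => A A0 cA iA; apply: contrapT => nogr.
have nogreatest (x : P) : A x -> ~ forall y : P, A y -> (y <= x)%O.
  by move=> Ax xmax; apply: nogr; exists x.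
have A_P2top : ~ A (P2top : P).
  by move=> /nogreatest; apply=> y _; apply: le_P2top.
have [x Ax] := A0.
have [m [k [Am _]]] := A_below_top cA iA A_P2top nogreatest Ax.
have [k' unb] := A_unbounded_level cA iA A_P2top nogreatest Am.
have [N hN] := A_bounded_pairs cA A_P2top k'.+1.
have [m' Nm' Am'] := unb N.
exact: (A_no_large_top cA iA A_P2top nogreatest hN Nm' Am').
Qed.

End Sobriety.

Theorem lemma4p9
  (i : ltpair -> set nat) (f : ltpair -> word -> nat) (phi : nat -> ltpair)
  (i_inj : injective i)
  (i_disj : forall p q : ltpair, p <> q -> i p `&` i q = set0)
  (i_gt : forall (p : ltpair) (k : nat), i p k -> psnd p < k)
  (f_mem : forall (p : ltpair) (s : word), i p (f p s))
  (f_mono : forall (p : ltpair) (s t : word), word_le s t -> f p s <= f p t)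
  (f_inj : forall p : ltpair, injective (f p))
  (phi_bij : bijective phi) :
  sober (Sigma (P2 i f phi)).
Proof. exact: P2_sober. Qed.
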